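(* Let the source data $(X_S,Y_S)$, kernel $k(x,x')=\langle\Phi(x),\Phi(x')\rangle$, kernel matrix $K_S=k(X_S,X_S)$, $\sigma_S>0$, source model $f_S(\cdot)^T=k(\cdot,X_S)[K_S+\sigma_S I]^{-1}Y_S$, input transformation $a$ with parameters $\theta_A$, linear output mapping $b\in\mathbb{R}^{c_T\times c_S}$, target model $f_T=b\circ f_S\circ a$, and target dataset $D_T$ with feature matrix $X_T$ be as in the context. Define $$\hat\Theta_T^A(x,x')=\nabla_{\theta_A}f_T(x)\,[\nabla_{\theta_A}f_T(x')]^T,\qquad \hat\Theta_A(x,x')=\nabla_{\theta_A}a(x)\,[\nabla_{\theta_A}a(x')]^T,$$ $$\hat\Theta_S^A(x,x')=\nabla_a\Phi(a(x))\,[\nabla_a\Phi(a(x'))]^T,\qquad \Theta_S^b=b\,Y_S^T[K_S+\sigma_S I]^{-1}K_S[K_S+\sigma_S I]^{-1}Y_S\,b^T .$$ Then for every $i\in\{1,\dots,N_Tc_T\}$, $$\lambda_i\big(\hat\Theta_T^A(X_T,X_T)\big)\le\lambda_{\max}[\Theta_S^b]\cdot\sup_{(x_t,y_t)\in D_T}\lambda_{\max}[\hat\Theta_S^A(x_t,x_t)]\cdot\lambda_{\max}[\hat\Theta_A(X_T,X_T)]$$ and $$\lambda_i\big(\hat\Theta_T^A(X_T,X_T)\big)\ge\lambda_{\min}[\Theta_S^b]\cdot\inf_{(x_t,y_t)\in D_T}\lambda_{\min}[\hat\Theta_S^A(x_t,x_t)]\cdot\lambda_{\min}[\hat\Thet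a_A(X_T,X_T)].$$
   Context: Source data: $X_S=[x_s^1,\dots,x_s^{N_S}]^T\in\mathbb{R}^{N_S\times d_S}$, $Y_S=[y_s^1,\dots,y_s^{N_S}]^T\in\mathbb{R}^{N_S\times c_S}$. Target data: $D_T=\{(x_i,y_i)\}_{i=1}^{N_T}$, $x_i\in\mathbb{R}^{d_T}$, $y_i\in\mathbb{R}^{c_T}$, with feature matrix $X_T\in\mathbb{R}^{N_T\times d_T}$. The kernel $k:\mathbb{R}^{d_S}\times\mathbb{R}^{d_S}\to\mathbb{R}$ (symmetric, positive semi-definite; induced by the neural tangent kernel of the source network) is given by a differentiable feature map $\Phi:\mathbb{R}^{d_S}\to\mathbb{R}^m$ as $k(x,x')=\langle\Phi(x),\Phi(x')\rangle$. $\Phi(X_S)$ is the $m\times N_S$ matrix with columns $\Phi(x_s^j)$, so $K_S=k(X_S,X_S)=\Phi(X_S)^T\Phi(X_S)$, and $k(x,X_S)=\Phi(x)^T\Phi(X_S)$ is a $1\times N_S$ row. The source model $f_S:\mathbb{R}^{d_S}\to\mathbb{R}^{c_S}$ is the fixed kernel model $f_S(x)^T=k(x,X_S)[K_S+\sigma_S I]^{-1}Y_S$ with $\sigma_S>0$. The input transformation $a=a_{\theta_A}:\mathbb{R}^{d_T}\to\mathbb{R}^{d_S}$ is differentiable in its parameter vector $\theta_A\in\mathbb{R}^{p_A}$. The output mapping $b$ is a linear map given by a $c_T\times c_S$ matrix. The target model is $f_T(x)=b\,f_S(a(x))$. All quantities are evaluated at fixed $\theta_A$ and $b$. $\nabla_{\theta_A}f_T(x)\in\mathbb{R}^{c_T\times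 p_A}$ and $\nabla_{\theta_A}a(x)\in\mathbb{R}^{d_S\times p_A}$ are Jacobians with respect to $\theta_A$; $\nabla_a\Phi(a(x))\in\mathbb{R}^{m\times d_S}$ is the Jacobian of $\Phi$ evaluated at $a(x)$. For a matrix-valued function $M(x,x')\in\mathbb{R}^{r\times r}$, $M(X_T,X_T)$ is the $N_Tr\times N_Tr$ block matrix whose $(i,j)$ block is $M(x_i,x_j)$. For a symmetric matrix, $\lambda_i$ is the $i$-th largest eigenvalue, and $\lambda_{\max},\lambda_{\min}$ are the largest and smallest eigenvalues. *)

(* Defs.v *)
From HB Require Import structures.
From mathcomp Require Import all_boot all_order all_algebra.
From mathcomp Require Import all_classical all_reals all_analysis.

Set Implicit Arguments.
Unset Strict Implicit.
Unset Printing Implicit Defensive.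

Import Order.TTheory GRing.Theory Num.Theory numFieldNormedType.Exports.

Local Open Scope classical_set_scope.
Local Open Scope ring_scope.

(* Points of R^n are row vectors 'rV[R]_n, so a data matrix
   has the data points as its rows and a matrix b acts on the right as b^T. *)

(* The eigenvalues in nonincreasing order, repeated according to multiplicity.
   Such a sequence exists (and is then unique) iff the characteristic
   polynomial splits over R, in particular whenever A is symmetric; otherwise
   this is the junk value [::]. *)
Definition eigenvalues (R : realType) (n : nat) (A : 'M[R]_n) : seq R :=
  xget [::] [set s : seq R | sorted >=%R s
                          /\ char_poly A = \prod_(z <- s) ('X - z%:P)].

(* 1-based: lambda 1 A is the largest eigenvalue. *)
Definition lambda (R : realType) (n : nat) (i : nat) (A : 'M[R]_n) : R :=
  nth 0 (eigenvalues A) i.-1.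

Definition lambda_max (R : realType) (n : nat) (A : 'M[R]_n) : R :=
  head 0 (eigenvalues A).

Definition lambda_min (R : realType) (n : nat) (A : 'M[R]_n) : R :=
  last 0 (eigenvalues A).

(* The library's [jacobian] acts on row vectors from the right; the usual
   m x n matrix of partial derivatives is its transpose. *)
Definition Jac (R : realType) (n m : nat) (f : 'rV[R]_n -> 'rV[R]_m)
    (p : 'rV[R]_n) : 'M[R]_(m, n) :=
  (jacobian f p)^T.

Definition dotp (R : realType) (n : nat) (u v : 'rV[R]_n) : R :=
  \sum_(j < n) u 0 j * v 0 j.

Definition feature_kernel (R : realType) (d m : nat) (Phi : 'rV[R]_d -> 'rV[R]_m)
    (x x' : 'rV[R]_d) : R :=
  dotp (Phi x) (Phi x').

Definition kernel_row (R : realType) (d N : nat)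
    (k : 'rV[R]_d -> 'rV[R]_d -> R) (x : 'rV[R]_d) (X : 'M[R]_(N, d)) :
    'rV[R]_N :=
  \row_(j < N) k x (row j X).

Definition kernel_mx (R : realType) (d N : nat)
    (k : 'rV[R]_d -> 'rV[R]_d -> R) (X : 'M[R]_(N, d)) : 'M[R]_N :=
  \matrix_(i < N, j < N) k (row i X) (row j X).

Definition source_model (R : realType) (dS cS NS : nat)
    (k : 'rV[R]_dS -> 'rV[R]_dS -> R)
    (XS : 'M[R]_(NS, dS)) (YS : 'M[R]_(NS, cS)) (sigmaS : R)
    (x : 'rV[R]_dS) : 'rV[R]_cS :=
  kernel_row k x XS *m invmx (kernel_mx k XS + sigmaS%:M) *m YS.

Definition target_model (R : realType) (pA dT dS cS cT : nat)
    (fS : 'rV[R]_dS -> 'rV[R]_cS) (a : 'rV[R]_pA -> 'rV[R]_dT -> 'rV[R]_dS)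
    (b : 'M[R]_(cT, cS)) (theta : 'rV[R]_pA) (x : 'rV[R]_dT) : 'rV[R]_cT :=
  fS (a theta x) *m b^T.

(* The kernel (x, x') |-> J(x) J(x')^T of the Jacobian in the parameters of a
   parametric map f. *)
Definition tangent_kernel (R : realType) (p d r : nat)
    (f : 'rV[R]_p -> 'rV[R]_d -> 'rV[R]_r) (theta : 'rV[R]_p)
    (x x' : 'rV[R]_d) : 'M[R]_r :=
  Jac (f^~ x) theta *m (Jac (f^~ x') theta)^T.

Definition Theta_SA (R : realType) (pA dT dS m : nat)
    (Phi : 'rV[R]_dS -> 'rV[R]_m) (a : 'rV[R]_pA -> 'rV[R]_dT -> 'rV[R]_dS)
    (theta : 'rV[R]_pA) (x x' : 'rV[R]_dT) : 'M[R]_m :=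
  Jac Phi (a theta x) *m (Jac Phi (a theta x'))^T.

Definition Theta_Sb (R : realType) (dS cS cT NS : nat)
    (k : 'rV[R]_dS -> 'rV[R]_dS -> R)
    (XS : 'M[R]_(NS, dS)) (YS : 'M[R]_(NS, cS)) (sigmaS : R)
    (b : 'M[R]_(cT, cS)) : 'M[R]_cT :=
  let KS := kernel_mx k XS in
  let G := invmx (KS + sigmaS%:M) in
  b *m YS^T *m G *m KS *m G *m YS *m b^T.

Definition feature_mx (R : realType) (dT cT NT : nat)
    (D : NT.-tuple ('rV[R]_dT * 'rV[R]_cT)) : 'M[R]_(NT, dT) :=
  \matrix_(i < NT) (tnth D i).1.

(* The size is \sum_(i < N) r, that is N * r by sum_nat_const and card_ord. *)
Definition block_eval (R : realType) (d r N : nat)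
    (M : 'rV[R]_d -> 'rV[R]_d -> 'M[R]_r) (X : 'M[R]_(N, d)) :
    'M[R]_(\sum_(i < N) r) :=
  \mxblock_(i < N, j < N) M (row i X) (row j X).

(* Main.v *)
(* Write f_T(x) = W^T Phi(a(x)), where W does not depend on theta and
   W^T W = Theta_S^b. By the chain rule the Jacobian of f_T at x_i is
   V P_i J_i with V = W^T, P_i the Jacobian of Phi at a(x_i) and J_i that of a.
   A test vector v with blocks v_i is thus pulled back to the vector with
   blocks v_i V P_i: the quadratic form of the target kernel at v is the one of
   the kernel of a at the pull-back, whose squared norm is
   sum_i v_i V (P_i P_i^T) V^T v_i^T. Three successive Rayleigh quotient bounds
   then compare it with |v|^2, and evaluating at an eigenvector of the target
   kernel gives both inequalities for every eigenvalue. *)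
Require Import Defs.
From HB Require Import structures.
From mathcomp Require Import all_boot all_order all_algebra.
From mathcomp Require Import all_classical all_reals all_analysis.
From mathcomp Require Import complex.

Set Implicit Arguments.
Unset Strict Implicit.
Unset Printing Implicit Defensive.

Import Order.TTheory GRing.Theory Num.Theory numFieldNormedType.Exports.

Local Open Scope classical_set_scope.
Local Open Scope ring_scope.

(** * Jacobians of compositions and of linear maps *)

Lemma continuous_mulmxr (R : realType) (m n : nat) (W : 'M[R]_(m, n)) :
  continuous (mulmxr W : 'rV[R]_m -> 'rV[R]_n).
Proof.
(* A finite sum of coordinates times fixed rows is continuous; continuity makes the linear map
   differentiable and its own differential. *)
have -> : (mulmxr W : 'rV[R]_m -> 'rV[R]_n) = fun u => \sum_i u 0 i *: row i W.
  by apply/funext => u; rewrite /= mulmx_sum_row.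
move=> u; apply: (@cvg_big _ _ _ _ _ _ _ (nbhs u)) => [|i _].
  exact: add_continuous.
apply: cvgZr_tmp; exact: coord_continuous.
Qed.

Lemma Jac_comp (R : realType) (p m n : nat) (f : 'rV[R]_p -> 'rV[R]_m)
    (g : 'rV[R]_m -> 'rV[R]_n) (x : 'rV[R]_p) :
  differentiable f x -> differentiable g (f x) ->
  Jac (g \o f) x = Jac g (f x) *m Jac f x.
Proof.
move=> df dg; rewrite /Jac -trmx_mul; congr (_^T); apply/row_matrixP => i.
by rewrite !rowE mulmxA !mul_rV_lin1 diff_comp.
Qed.

Lemma Jac_mulmxr (R : realType) (m n : nat) (W : 'M[R]_(m, n)) (x : 'rV[R]_m) :
  Jac (mulmxr W) x = W^T.
Proof.
rewrite /Jac; congr (_^T); apply/row_matrixP => i.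
rewrite !rowE mul_rV_lin1 diff_lin //.
exact: continuous_mulmxr.
Qed.

(** * Spectral decomposition of real symmetric matrices *)

Lemma char_poly_conj (F : fieldType) (n : nat) (U D : 'M[F]_n) :
  U \in unitmx -> char_poly (invmx U *m D *m U) = char_poly D.
Proof.
move=> unitU; pose c (M : 'M[F]_n) := map_mx polyC M.
have cVU : c (invmx U) *m c U = 1%:M by rewrite -map_mxM mulVmx // map_mx1.
have -> : char_poly (invmx U *m D *m U) =
    \det (c (invmx U) *m char_poly_mx D *m c U).
  congr (\det _); rewrite /char_poly_mx mulmxBr mulmxBl !map_mxM /=.
  by rewrite scalar_mxC -(mulmxA 'X%:M) cVU mulmx1.
by rewrite !det_mulmx mulrAC -det_mulmx cVU det1 mul1r.
Qed.

Definition qform (R : realType) (n : nat) (A : 'M[R]_n) (v : 'rV[R]_n) : R :=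
  (v *m A *m v^T) 0 0.

Lemma qform1 (R : realType) (n : nat) (v : 'rV[R]_n) :
  qform 1%:M v = dotp v v.
Proof.
by rewrite /qform mulmx1 mxE; apply: eq_bigr => i _; rewrite mxE.
Qed.

(* [w i] is the squared modulus of the i-th coordinate of [v] in a unitary
   eigenbasis of [A] over R[i]. *)
Lemma symmetric_spectral (R : realType) (n : nat) (A : 'M[R]_n) :
  A^T = A ->
  exists d : 'rV[R]_n,
    char_poly A = \prod_i ('X - (d 0 i)%:P) /\
    forall v, exists w : 'I_n -> R,
      [/\ forall i, 0 <= w i, dotp v v = \sum_i w i
        & qform A v = \sum_i d 0 i * w i].
Proof.
(* Over [R[i]] the matrix is hermitian, so a unitary [U] diagonalizes it and the diagonal is real;
   [d] is that diagonal read in [R]. *)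
move=> symA; pose toC := real_complex R; pose AC := map_mx toC A.
have hermA : AC \is hermsymmx.
  apply: realsym_hermsym.
    apply/is_hermitianmxP/matrixP => i j.
    by rewrite expr0 scale1r !mxE -[in LHS]symA mxE.
  by apply/mxOverP => i j; rewrite mxE; apply/complex_realP; exists (A i j).
have /mxOverP realD := hermitian_spectral_diag_real hermA.
pose d : 'rV[R]_n := map_mx (@complex.Re R) (spectral_diag AC).
have dE : map_mx toC d = spectral_diag AC.
  by apply/matrixP => i j; rewrite !mxE; apply: RRe_real.
have := hermitian_normalmx hermA => /orthomx_spectralP.
have := spectral_unitarymx AC.
set U := spectralmx AC; rewrite -dE => unitU AE.
have UU := unitarymx_unit unitU.
exists d; split.
  apply: (map_poly_inj toC); rewrite map_char_poly rmorph_prod -/AC AE.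
  rewrite char_poly_conj // char_poly_trig ?diag_mx_is_trig //.
  apply: eq_bigr => i _.
  by rewrite rmorphB /= map_polyX map_polyC !mxE eqxx mulr1n.
move=> v; pose z := map_mx toC v *m invmx U.
pose w i := complex.Re (z 0 i * (z 0 i)^*).
have wE i : toC (w i) = z 0 i * (z 0 i)^*.
  by apply: RRe_real; apply: ger0_real; exact: mul_conjC_ge0.
(* Stated for every [M] diagonalized by the same [U], so that [A] and the identity share the weights
   [w]. *)
have qE (M : 'M[R]_n) (e : 'rV[R]_n) :
    map_mx toC M = invmx U *m diag_mx (map_mx toC e) *m U ->
    qform M v = \sum_i e 0 i * w i.
  move=> ME; apply: (@complexI R); rewrite rmorph_sum /=.
  transitivity ((map_mx toC (v *m M *m v^T)) 0 0); first by rewrite mxE.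
  rewrite !map_mxM ME !mulmxA -/z -mulmxA.
  (* [invmx U] is the conjugate transpose of [U], and [v] is real. *)
  have -> : U *m map_mx toC v^T = map_mx Num.conj z^T.
    rewrite /z invmx_unitary // trmx_mul map_mxM /= trmxCK.
    congr (_ *m _); apply/matrixP => i j; rewrite !mxE.
    by apply/esym/CrealP/complex_realP; eexists.
  rewrite mxE; apply: eq_bigr => i _; rewrite rmorphM /=.
  have -> : (map_mx Num.conj z^T) i 0 = (z 0 i)^* by rewrite !mxE.
  have -> : (z *m diag_mx (map_mx toC e)) 0 i = z 0 i * toC (e 0 i).
    by rewrite mul_mx_diag mxE [X in _ * X]mxE.
  by rewrite [X in _ = _ * X]wE mulrAC mulrC.
exists w; split=> [i||].
- by rewrite -ler0c [X in _ <= X]wE mul_conjC_ge0.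
- rewrite -qform1 (qE _ (const_mx 1)).
    by apply: eq_bigr => i _; rewrite mxE mul1r.
  by rewrite map_const_mx diag_const_mx map_mx1 mulmx1 mulVmx.
- exact: qE.
Qed.

(** * Quadratic forms and Gram matrices *)

Lemma qform_conj (R : realType) (m n : nat) (B : 'M[R]_(m, n)) (A : 'M[R]_n)
    (v : 'rV[R]_m) :
  qform (B *m A *m B^T) v = qform A (v *m B).
Proof. by rewrite /qform trmx_mul !mulmxA. Qed.

Lemma qform_gram (R : realType) (m n : nat) (B : 'M[R]_(m, n)) (v : 'rV[R]_m) :
  qform (B *m B^T) v = dotp (v *m B) (v *m B).
Proof. by rewrite -[B in B *m _]mulmx1 qform_conj qform1. Qed.

Lemma gram_sym (R : realType) (m n : nat) (B : 'M[R]_(m, n)) :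
  (B *m B^T)^T = B *m B^T.
Proof. by rewrite trmx_mul trmxK. Qed.

Lemma dotp_ge0 (R : realType) (n : nat) (v : 'rV[R]_n) : 0 <= dotp v v.
Proof. by apply: sumr_ge0 => j _; rewrite -expr2 sqr_ge0. Qed.

Lemma dotp_gt0 (R : realType) (n : nat) (v : 'rV[R]_n) : v != 0 -> 0 < dotp v v.
Proof.
move=> v0; rewrite lt_def dotp_ge0 andbT; apply: contra v0.
rewrite psumr_eq0 => [/allP v0|j _]; last by rewrite -expr2 sqr_ge0.
apply/eqP/rowP => j; rewrite mxE; apply/eqP.
by rewrite -sqrf_eq0 expr2; apply: v0; rewrite mem_index_enum.
Qed.

(** * Ordered eigenvalues and Rayleigh bounds *)

Lemma eigenvalues_spec (R : realType) (n : nat) (A : 'M[R]_n) :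
  A^T = A -> sorted >=%R (eigenvalues A) /\
             char_poly A = \prod_(z <- eigenvalues A) ('X - z%:P).
Proof.
move=> /symmetric_spectral [d [dE _]].
apply: (@xgetPex _ [::] [set s : seq R | sorted >=%R s
                          /\ char_poly A = \prod_(z <- s) ('X - z%:P)]).
(* The sorted spectral diagonal is a witness, so the choice in [eigenvalues] does not fall back on
   its default. *)
exists (sort >=%R [seq d 0 i | i <- enum 'I_n]); split.
  by apply: sort_sorted => x y; exact: le_total.
rewrite dE -big_enum -(big_map _ xpredT (fun z => 'X - z%:P)).
by apply: perm_big; rewrite perm_sym perm_sort.
Qed.

Lemma size_eigenvalues (R : realType) (n : nat) (A : 'M[R]_n) :
  A^T = A -> size (eigenvalues A) = n.
Proof.
move=> /eigenvalues_spec [_ AE]; have := size_char_poly A.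
by rewrite AE size_prod_XsubC => -[].
Qed.

Lemma lambda_maxE (R : realType) (n : nat) (A : 'M[R]_n) :
  lambda_max A = lambda 1 A.
Proof. by rewrite /lambda /lambda_max -nth0. Qed.

Lemma lambda_minE (R : realType) (n : nat) (A : 'M[R]_n) :
  A^T = A -> lambda_min A = lambda n A.
Proof.
by move=> symA; rewrite /lambda -[n in n.-1](size_eigenvalues symA) nth_last.
Qed.

Lemma rayleigh (R : realType) (n : nat) (A : 'M[R]_n) (v : 'rV[R]_n) :
  A^T = A ->
  lambda_min A * dotp v v <= qform A v <= lambda_max A * dotp v v.
Proof.
move=> symA; have [d [dE /(_ v) [w [w_ge0 -> ->]]]] := symmetric_spectral symA.
have [srt cE] := eigenvalues_spec symA; have sz := size_eigenvalues symA.
have geT : transitive (>=%R : rel R).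
  by move=> x y z xy yz; exact: le_trans yz xy.
have mono := sorted_leq_nth geT (@lexx _ R) 0 srt.
(* The weights [w] are nonnegative and sum to [dotp v v], so bounding each spectral value
   suffices. *)
suff d_le i : lambda_min A <= d 0 i <= lambda_max A.
  rewrite !mulr_sumr; apply/andP; split; apply: ler_sum => i _;
    by have /andP[] := d_le i; move=> *; exact: ler_wpM2r.
(* A spectral value is a root of the characteristic polynomial, hence an entry of the sorted
   list. *)
have : d 0 i \in eigenvalues A.
  rewrite -root_prod_XsubC -cE dE rootE horner_prod prodf_seq_eq0.
  by apply/hasP; exists i; rewrite ?mem_index_enum //= hornerXsubC subrr.
case/(nthP 0) => k; rewrite sz => kn <-.
rewrite lambda_maxE (lambda_minE symA) /lambda.
have n_gt0 := leq_ltn_trans (leq0n k) kn.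
apply/andP; split; apply: mono; rewrite ?inE ?sz //= ?prednK //.
by rewrite -ltnS prednK.
Qed.

Lemma lambda_eigenvector (R : realType) (n i : nat) (A : 'M[R]_n) :
  A^T = A -> (1 <= i <= n)%N ->
  exists2 v : 'rV[R]_n, v != 0 & qform A v = lambda i A * dotp v v.
Proof.
move=> symA /andP[i_gt0 i_le]; have [_ cE] := eigenvalues_spec symA.
have : eigenvalue A (lambda i A).
  rewrite eigenvalue_root_char cE root_prod_XsubC mem_nth //.
  by rewrite size_eigenvalues // prednK.
case/eigenvalueP => v vA v0; exists v => //.
by rewrite /qform vA -qform1 /qform mulmx1 -scalemxAl mxE.
Qed.

(** Test the bound at an eigenvector and divide by its positive squared norm. *)
Lemma lambda_le (R : realType) (n i : nat) (A : 'M[R]_n) (c : R) :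
  A^T = A -> (1 <= i <= n)%N -> (forall v, qform A v <= c * dotp v v) ->
  lambda i A <= c.
Proof.
move=> symA hi bnd; have [v v0 vE] := lambda_eigenvector symA hi.
by have := bnd v; rewrite vE ler_pM2r ?dotp_gt0.
Qed.

Lemma lambda_ge (R : realType) (n i : nat) (A : 'M[R]_n) (c : R) :
  A^T = A -> (1 <= i <= n)%N -> (forall v, c * dotp v v <= qform A v) ->
  c <= lambda i A.
Proof.
move=> symA hi bnd; have [v v0 vE] := lambda_eigenvector symA hi.
by have := bnd v; rewrite vE ler_pM2r ?dotp_gt0.
Qed.

Lemma lambda_gram_ge0 (R : realType) (m n i : nat) (B : 'M[R]_(m, n)) :
  0 <= lambda i (B *m B^T).
Proof.
(* Past the end of the list, [lambda] is the default 0. *)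
have [i_lt|i_ge] := ltnP i.-1 m; last first.
  by rewrite /lambda nth_default // size_eigenvalues ?gram_sym.
(* Index 0 reads the same entry as index 1, so [i.-1.+1] can stand for [i] and is at least 1. *)
rewrite -[lambda i _]/(lambda i.-1.+1 _).
apply: lambda_ge => [||v]; [exact: gram_sym | by [] |].
by rewrite mul0r qform_gram dotp_ge0.
Qed.

Lemma lambda_max_gram_ge0 (R : realType) (m n : nat) (B : 'M[R]_(m, n)) :
  0 <= lambda_max (B *m B^T).
Proof. by rewrite lambda_maxE lambda_gram_ge0. Qed.

Lemma lambda_min_gram_ge0 (R : realType) (m n : nat) (B : 'M[R]_(m, n)) :
  0 <= lambda_min (B *m B^T).
Proof. by rewrite lambda_minE ?gram_sym // lambda_gram_ge0. Qed.

(** * Boundedness over finite data, and block matrices *)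

Lemma has_ubound_seq (R : realType) (T : choiceType) (f : T -> R) (s : seq T) :
  has_ubound [set f x | x in [set` s]].
Proof.
(* The sum of all absolute values dominates each value. *)
exists (\sum_(x <- s) `|f x|) => _ [x /= xs <-].
rewrite (big_rem x) //=; apply: le_trans (ler_norm _) _.
by rewrite lerDl sumr_ge0.
Qed.

Lemma dotp_mxrow (R : realType) (N r : nat) (u : 'I_N -> 'rV[R]_r) :
  dotp (\mxrow_(i < N) u i) (\mxrow_(i < N) u i) = \sum_i dotp (u i) (u i).
Proof.
have dE n (v : 'rV[R]_n) : dotp v v = (v *m v^T) 0 0.
  by rewrite -qform1 /qform mulmx1.
rewrite dE tr_mxrow mul_mxrow_mxcol summxE.
by apply: eq_bigr => i _; rewrite dE.
Qed.

(** Stacking the Jacobians turns a block kernel into a Gram matrix, hence symmetric with nonnegative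
    eigenvalues. *)
Lemma block_gram (R : realType) (N r p : nat) (J : 'I_N -> 'M[R]_(r, p)) :
  \mxblock_(i < N, j < N) (J i *m (J j)^T) =
  (\mxcol_(i < N) J i) *m (\mxcol_(i < N) J i)^T.
Proof. by rewrite tr_mxcol mul_mxcol_mxrow. Qed.

(** * Rayleigh bounds for a factored block kernel *)

Section FactoredGram.
Variables (R : realType) (N r m s p : nat) (V : 'M[R]_(r, m)).
Variables (P : 'I_N -> 'M[R]_(m, s)) (J : 'I_N -> 'M[R]_(s, p)).

Let F i := V *m P i *m J i.
Let T := \mxblock_(i < N, j < N) (F i *m (F j)^T).
Let A := \mxblock_(i < N, j < N) (J i *m (J j)^T).
Let pull (v : 'rV[R]_(\sum_(i < N) r)) :=
  \mxrow_(i < N) (submxrow v i *m (V *m P i)).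

Let symT : T^T = T. Proof. by rewrite /T block_gram gram_sym. Qed.
Let symA : A^T = A. Proof. by rewrite /A block_gram gram_sym. Qed.

(** Both sides are the squared norm of the sum of the [v_i V P_i J_i], bracketed differently. *)
Let qform_pull v : qform T v = qform A (pull v).
Proof.
rewrite /T /A !block_gram !qform_gram; set u := v *m _; set w := pull v *m _.
suff -> : u = w by [].
rewrite /u /w /pull -[v in LHS]submxrowK !mul_mxrow_mxcol.
by apply: eq_bigr => i _; rewrite !mulmxA.
Qed.

Let dotp_pull v : dotp (pull v) (pull v) =
  \sum_i qform (P i *m (P i)^T) (submxrow v i *m V).
Proof.
by rewrite dotp_mxrow; apply: eq_bigr => i _; rewrite qform_gram mulmxA.
Qed.

Let dotp_split (v : 'rV[R]_(\sum_(i < N) r)) :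
  dotp v v = \sum_i dotp (submxrow v i) (submxrow v i).
Proof. by rewrite -[in LHS](submxrowK v) dotp_mxrow. Qed.

Lemma lambda_factored_le (k : nat) (c : R) :
  0 <= c -> (forall i, lambda_max (P i *m (P i)^T) <= c) ->
  (1 <= k <= N * r)%N ->
  lambda k T <= lambda_max (V *m V^T) * c * lambda_max A.
Proof.
move=> c_ge0 Pc hk; apply: (lambda_le symT) => [|v].
  by rewrite sum_nat_const card_ord.
rewrite qform_pull; have /andP[_ /le_trans->] // := rayleigh (pull v) symA.
(* The common factor [lambda_max A] is nonnegative because [A] is a Gram matrix, so it can be
   removed. *)
rewrite mulrAC mulrC; apply: ler_wpM2r.
  by rewrite /A block_gram lambda_max_gram_ge0.
rewrite dotp_pull dotp_split mulr_sumr; apply: ler_sum => i _.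
(* Two more Rayleigh bounds in each block: for [P i] at [v_i V], then for [V] at [v_i]. *)
have /andP[_ /le_trans->] // := rayleigh (submxrow v i *m V) (gram_sym (P i)).
rewrite -qform_gram mulrAC [leRHS]mulrC.
apply: ler_pM => //; [exact: lambda_max_gram_ge0 | | ].
  by rewrite qform_gram dotp_ge0.
by have /andP[] := rayleigh (submxrow v i) (gram_sym V).
Qed.

(** The same chain with lower bounds; multiplying them uses [0 <= c]. *)
Lemma lambda_factored_ge (k : nat) (c : R) :
  0 <= c -> (forall i, c <= lambda_min (P i *m (P i)^T)) ->
  (1 <= k <= N * r)%N ->
  lambda_min (V *m V^T) * c * lambda_min A <= lambda k T.
Proof.
move=> c_ge0 Pc hk; apply: (lambda_ge symT) => [|v].
  by rewrite sum_nat_const card_ord.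
rewrite qform_pull; have /andP[/(le_trans _)->] // := rayleigh (pull v) symA.
rewrite mulrAC [leRHS]mulrC; apply: ler_wpM2r.
  by rewrite /A block_gram lambda_min_gram_ge0.
rewrite dotp_pull dotp_split mulr_sumr; apply: ler_sum => i _.
have /andP[/(le_trans _)->] // := rayleigh (submxrow v i *m V) (gram_sym (P i)).
rewrite -qform_gram mulrAC mulrC.
apply: ler_pM => //; first by rewrite mulr_ge0 ?lambda_min_gram_ge0 ?dotp_ge0.
by have /andP[] := rayleigh (submxrow v i) (gram_sym V).
Qed.

End FactoredGram.

(** * Factorisation of the source model through the feature map *)

Section SourceFactor.
Variables (R : realType) (dS cS cT m NS : nat).
Variables (XS : 'M[R]_(NS, dS)) (YS : 'M[R]_(NS, cS)).
Variables (Phi : 'rV[R]_dS -> 'rV[R]_m) (sigmaS : R) (b : 'M[R]_(cT, cS)).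

Let k := feature_kernel Phi.
Let F : 'M[R]_(NS, m) := \matrix_(j < NS) Phi (row j XS).

(** The matrix [W] with f_T(x) = Phi(a(x)) W; the rows of [F] are the source features, so [F^T] is
    Phi(X_S). *)
Definition source_factor : 'M[R]_(m, cT) :=
  F^T *m invmx (kernel_mx k XS + sigmaS%:M) *m YS *m b^T.

Let kernel_mx_gram : kernel_mx k XS = F *m F^T.
Proof.
apply/matrixP => i j; rewrite !mxE.
by apply: eq_bigr => l _; rewrite !mxE.
Qed.

Lemma target_modelE (pA dT : nat) (a : 'rV[R]_pA -> 'rV[R]_dT -> 'rV[R]_dS)
    (theta : 'rV[R]_pA) (x : 'rV[R]_dT) :
  target_model (source_model k XS YS sigmaS) a b theta x =
  Phi (a theta x) *m source_factor.
Proof.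
rewrite /target_model /source_model /source_factor !mulmxA.
congr (_ *m _ *m _ *m _); apply/rowP => j; rewrite !mxE.
by apply: eq_bigr => l _; rewrite !mxE.
Qed.

(** The middle K_S splits as [F *m F^T] and the regularized inverse is symmetric. The result has the
    form [V *m V^T] of the factored bounds, with [V = W^T]. *)
Lemma Theta_Sb_gram :
  Theta_Sb k XS YS sigmaS b = source_factor^T *m source_factor^T^T.
Proof.
rewrite /Theta_Sb /source_factor trmxK !trmx_mul !trmxK trmx_inv.
have -> : (kernel_mx k XS + sigmaS%:M)^T = kernel_mx k XS + sigmaS%:M.
  by rewrite kernel_mx_gram linearD /= tr_scalar_mx gram_sym.
by rewrite [X in _ *m X *m invmx _]kernel_mx_gram !mulmxA.
Qed.

End SourceFactor.

(** * Eigenvalue bounds for the tangent kernel of the target model *)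

Theorem theorem2 (R : realType) (dS cS dT cT m pA NS NT : nat)
    (XS : 'M[R]_(NS, dS)) (YS : 'M[R]_(NS, cS))
    (DT : NT.-tuple ('rV[R]_dT * 'rV[R]_cT))
    (Phi : 'rV[R]_dS -> 'rV[R]_m)
    (hPhi : forall x : 'rV[R]_dS, differentiable Phi x)
    (sigmaS : R) (hsigmaS : 0 < sigmaS)
    (a : 'rV[R]_pA -> 'rV[R]_dT -> 'rV[R]_dS)
    (ha : forall (x : 'rV[R]_dT) (theta : 'rV[R]_pA),
        differentiable (a^~ x) theta)
    (b : 'M[R]_(cT, cS)) (thetaA : 'rV[R]_pA) (i : nat)
    (hi : (1 <= i <= NT * cT)%N) :
  let k := feature_kernel Phi in
  let fS := source_model k XS YS sigmaS in
  let fT := target_model fS a b in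
  let XT := feature_mx DT in
  let ThetaTA := tangent_kernel fT thetaA in
  let ThetaA := tangent_kernel a thetaA in
  let ThetaSA := Theta_SA Phi a thetaA in
  let ThetaSb := Theta_Sb k XS YS sigmaS b in
  lambda i (block_eval ThetaTA XT) <=
    lambda_max ThetaSb
    * sup [set lambda_max (ThetaSA xy.1 xy.1) | xy in [set` DT]]
    * lambda_max (block_eval ThetaA XT)
  /\
  lambda_min ThetaSb
    * inf [set lambda_min (ThetaSA xy.1 xy.1) | xy in [set` DT]]
    * lambda_min (block_eval ThetaA XT)
  <= lambda i (block_eval ThetaTA XT).
Proof.
move=> k fS fT XT ThetaTA ThetaA ThetaSA ThetaSb.
set W := source_factor XS YS Phi sigmaS b.
have JacfT x : Jac (fT^~ x) thetaA =
    W^T *m Jac Phi (a thetaA x) *m Jac (a^~ x) thetaA.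
  (* As a function of theta, only the innermost map [a^~ x] varies; Phi and a fixed linear map
     follow it. *)
  have -> : fT^~ x = mulmxr W \o (Phi \o a^~ x).
    by apply/funext => theta; rewrite /= /fT target_modelE.
  have dPhia : differentiable (Phi \o a^~ x) thetaA.
    exact: differentiable_comp.
  have dW : differentiable (mulmxr W) (Phi (a thetaA x)).
    exact/linear_differentiable/continuous_mulmxr.
  rewrite (Jac_comp dPhia dW) (Jac_comp (ha x thetaA) (hPhi _)).
  by rewrite Jac_mulmxr mulmxA.
have XTE j : row j XT = (tnth DT j).1 by rewrite rowK.
have DTj j : [set` DT] (tnth DT j) by exact: mem_tnth.
(* An admissible [i] forces a data point to exist, so [sup] and [inf] below are over nonempty
   sets. *)
have NT_gt0 : (0 < NT)%N.
  by have /andP[/leq_trans h /h] := hi; rewrite muln_gt0 => /andP[].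
set u := sup _; set l := inf _.
have u_ge j : lambda_max (ThetaSA (row j XT) (row j XT)) <= u.
  apply: ub_le_sup; first exact: has_ubound_seq.
  by exists (tnth DT j); rewrite ?XTE.
have l_le j : l <= lambda_min (ThetaSA (row j XT) (row j XT)).
  (* Gram eigenvalues are bounded below by 0, which makes the infimum a genuine lower bound. *)
  apply: ge_inf.
    by exists 0 => _ [xy _ <-]; exact: lambda_min_gram_ge0.
  by exists (tnth DT j); rewrite ?XTE.
have l_ge0 : 0 <= l.
  apply: lb_le_inf; first by eexists; exists (tnth DT (Ordinal NT_gt0)).
  by move=> _ [xy _ <-]; exact: lambda_min_gram_ge0.
have u_ge0 : 0 <= u.
  by apply: le_trans (u_ge (Ordinal NT_gt0)); exact: lambda_max_gram_ge0.
(* The shape of the factored bounds, with [V = W^T] and with [P], [J] the Jacobians of Phi and [a]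
   at the data points. *)
have -> : block_eval ThetaTA XT =
    \mxblock_(j < NT, j' < NT)
      ((W^T *m Jac Phi (a thetaA (row j XT)) *m Jac (a^~ (row j XT)) thetaA) *m
       (W^T *m Jac Phi (a thetaA (row j' XT)) *m Jac (a^~ (row j' XT)) thetaA)^T).
  by apply: eq_mxblock => j j'; rewrite /ThetaTA /tangent_kernel !JacfT.
rewrite /ThetaSb Theta_Sb_gram -/W.
split; [exact: lambda_factored_le | exact: lambda_factored_ge].
Qed.
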